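(* For every $r>0$ and $\varepsilon>0$, there are positive semidefinite matrices $A,B\in\mathbb M_3(\mathbb C)$ and a normal matrix $N\in\mathbb M_3(\mathbb C)$ such that $$\begin{bmatrix}A&N\\N^*&B\end{bmatrix}\ge0,\qquad \sigma(N)\subseteq\{z\in\mathbb C:|z|\le r\},$$ and $$\lambda_1\left(\begin{bmatrix}A&N\\N^*&B\end{bmatrix}\right)>\lambda_1(A+B)+r-\varepsilon .$$ Hence the coefficient $1$ of $r$ in the estimate $$\lambda_{1+2j}\left(\begin{bmatrix}A&N\\N^*&B\end{bmatrix}\right)\le\lambda_{1+j}(A+B)+r,\qquad j=0,\dots,n-1$$ (for positive semidefinite block matrices with $A,B,N\in\mathbb M_n(\mathbb C)$ and $N$ normal with spectrum contained in a disk of radius $r$) is best possible already for $j=0$; that is, if $\kappa\in\mathbb R$ is such that for all such $n$, $A,B,N$ and $r$ one has $\lambda_1\left(\begin{bmatrix}A&N\\N^*&B\end{bmatrix}\right)\le\lambda_1(A+B)+\kappa r$, then $\kappa\ge1$.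
   Context: $\mathbb M_n(\mathbb C)$ is the algebra of complex $n\times n$ matrices. For Hermitian $T$, $T\ge 0$ means positive semidefinite, and $\lambda_1(T)\ge\lambda_2(T)\ge\cdots$ are the eigenvalues counted with multiplicity in nonincreasing order. $\sigma(N)$ is the spectrum of $N$. The displayed estimate with coefficient $1$ is a known theorem of Bourin and Lee. *)

(* Defs.v *)
From mathcomp Require Import all_boot all_order all_algebra.
From mathcomp Require Import reals.
From mathcomp Require Import complex.

Set Implicit Arguments.
Unset Strict Implicit.
Unset Printing Implicit Defensive.

Import Order.TTheory GRing.Theory Num.Theory.
Local Open Scope ring_scope.
Local Open Scope sesquilinear_scope.
Local Open Scope complex_scope.

(* In the order of R[i], 0 <= z means that z is real and nonnegative. *)
Definition psdmx (R : realType) (n : nat) (T : 'M[R[i]]_n) : Prop :=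
  T \is hermsymmx /\ forall x : 'cV[R[i]]_n, 0 <= (x^t* *m T *m x) 0 0.

(* The roots of the characteristic polynomial, listed with multiplicity. *)
Definition eigenvalues (R : realType) (n : nat) (T : 'M[R[i]]_n) : seq R[i] :=
  sval (closed_field_poly_normal (char_poly T)).

(* The index k starts at 1. The eigenvalues of a Hermitian matrix are real, so
   taking real parts only moves them from R[i] to R; lambda is meant for
   Hermitian T and 1 <= k <= n, and is a junk value otherwise. *)
Definition lambda (R : realType) (n : nat) (k : nat) (T : 'M[R[i]]_n) : R :=
  nth 0 (sort (fun x y : R => y <= x)
              [seq complex.Re z | z <- eigenvalues T]) k.-1.

Definition blockmx (R : realType) (n : nat) (A N B : 'M[R[i]]_n) :
  'M[R[i]]_(n + n) := block_mx A N (N^t*) B.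

(* eigenvalue N z (for row vectors, v *m N = z *: v) is equivalent to z being
   in the spectrum of the square matrix N. *)
Definition spectrum_in_disk (R : realType) (n : nat) (N : 'M[R[i]]_n)
    (c : R[i]) (r : R) : Prop :=
  forall z : R[i], eigenvalue N z -> `|z - c| <= r%:C.

(* Main.v *)
(** Take N = r P with P a cyclic 3x3 permutation matrix, and A, B diagonal.
    The block matrix splits into the three 2x2 blocks [[a_i, r], [r, b_(i+1)]]
    with A = diag (t, d, r^2/d), B = diag (d, t, r^2/d) and t = 2 r^2/d.  The
    first block has eigenvalue t + r and the other two are singular, whereas
    the largest entry of A + B is t + d, with d > 0 arbitrarily small. *)
Require Import Defs.
From mathcomp Require Import all_boot all_order all_algebra.
From mathcomp Require Import reals.
From mathcomp Require Import complex.
From mathcomp Require Import perm ring lra.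

Set Implicit Arguments.
Unset Strict Implicit.
Unset Printing Implicit Defensive.

Import Order.TTheory GRing.Theory Num.Theory.
Local Open Scope ring_scope.
Local Open Scope sesquilinear_scope.
Local Open Scope complex_scope.

Section Lambda1.
Variables (R : realType) (n : nat).
Implicit Types (T : 'M[R[i]]_n) (z : R[i]).

Lemma mem_eigenvalues T z : (z \in eigenvalues T) = eigenvalue T z.
Proof.
rewrite eigenvalue_root_char /eigenvalues.
case: closed_field_poly_normal => s /= ->.
by rewrite (monicP (char_poly_monic T)) scale1r root_prod_XsubC.
Qed.

Lemma size_eigenvalues T : size (eigenvalues T) = n.
Proof.
have := size_char_poly T; rewrite /eigenvalues.
case: closed_field_poly_normal => s /= ->.
by rewrite (monicP (char_poly_monic T)) scale1r size_prod_XsubC => -[].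
Qed.

(** Index 1 reads the head of a list sorted in nonincreasing order, and the head dominates every
    entry. With the next lemma this makes [lambda 1] the largest real part of an eigenvalue, so no
    explicit spectrum has to be computed. *)
Lemma lambda1_ge_eigenvalue T z : eigenvalue T z -> complex.Re z <= lambda 1 T.
Proof.
rewrite -mem_eigenvalues => /(map_f (@complex.Re R)); rewrite /lambda /=.
move: [seq complex.Re w | w <- eigenvalues T] => t.
set leT := fun x y : R => y <= x.
have leT_tr : transitive leT by move=> x y w /= xy /le_trans; apply.
have leT_total : total leT by move=> x y; exact: le_total.
rewrite -(mem_sort leT); have := sort_sorted leT_total t.
case: (sort leT t) => [//|x u] /= /(order_path_min leT_tr)/allP xu.
by rewrite inE => /orP[/eqP-> //|/xu].
Qed.

(** For [n > 0] the list is nonempty, so [nth] returns a genuine entry and not its default 0. *)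
Lemma lambda1_eigenvalue T :
  (0 < n)%N -> exists2 z, eigenvalue T z & lambda 1 T = complex.Re z.
Proof.
move=> n_gt0; rewrite /lambda /=; set t := sort _ _.
have : nth 0 t 0 \in t by rewrite mem_nth // size_sort size_map size_eigenvalues.
by rewrite mem_sort => /mapP[z]; rewrite mem_eigenvalues => zT ->; exists z.
Qed.

End Lambda1.

Section PermutationBlock.
Variables (R : realType) (n : nat).
Implicit Types (a b : 'I_n -> R) (r : R) (s : 'S_n).

Definition diagc a : 'M[R[i]]_n := diag_mx (\row_i (a i)%:C).

Definition permc r s : 'M[R[i]]_n := r%:C *: perm_mx s.

Lemma mul_row_diagc (v : 'rV_n) a j : (v *m diagc a) 0 j = v 0 j * (a j)%:C.
Proof. by rewrite mul_mx_diag !mxE. Qed.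

Lemma mul_row_permc (v : 'rV_n) r s j :
  (v *m permc r s) 0 j = r%:C * v 0 (s^-1%g j).
Proof. by rewrite -scalemxAr mxE -{1}[s]invgK -col_permE mxE. Qed.

Lemma adj_diagc a : (diagc a)^t* = diagc a.
Proof.
apply/matrixP => i j; rewrite !mxE eq_sym; case: eqP => [->|_] /=.
  by rewrite !mulr1n; exact: conjc_real.
by rewrite !mulr0n rmorph0.
Qed.

Lemma adj_permc r s : (permc r s)^t* = permc r s^-1.
Proof.
rewrite /permc linearZ /= map_mxZ tr_perm_mx map_perm_mx.
by congr (_ *: _); exact: conjc_real.
Qed.

Lemma permc_normal r s : permc r s \is normalmx.
Proof.
apply/normalmxP; rewrite adj_permc /permc -!scalemxAl -!scalemxAr -!perm_mxM.
by rewrite mulgV mulVg.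
Qed.

(** An eigenvector satisfies [z * v (s i) = r * v i]. Taking moduli and summing over [i], the
    permutation leaves the l1 norm of [v] unchanged, and this nonzero norm cancels. *)
Lemma norm_eigenvalue_permc r s z :
  0 <= r -> eigenvalue (permc r s) z -> `|z| = r%:C.
Proof.
move=> r_ge0 /eigenvalueP[v vz v_neq0].
have zv i : z * v 0 (s i) = r%:C * v 0 i.
  by rewrite -[i in RHS](permK s) -mul_row_permc vz mxE.
have sum_neq0 : \sum_i `|v 0 i| != 0.
  apply: contraNneq v_neq0 => sum0; apply/eqP/rowP => i; rewrite mxE.
  by apply/eqP; rewrite -normr_eq0 (psumr_eq0P _ sum0).
apply: (mulIf sum_neq0); rewrite [in LHS](reindex_inj (@perm_inj _ s)) /=.
rewrite !mulr_sumr; apply: eq_bigr => i _.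
by rewrite -normrM zv normrM (@ger0_norm _ r%:C) // ler0c.
Qed.

(** At a coordinate where the eigenvector does not vanish, the eigenvalue equals the diagonal
    entry. *)
Lemma lambda1_diagc_le a c :
  (0 < n)%N -> (forall i, a i <= c) -> lambda 1 (diagc a) <= c.
Proof.
move=> n_gt0 ac; have [z /eigenvalueP[v vz v_neq0] ->] :=
  lambda1_eigenvalue (diagc a) n_gt0.
have /rV0Pn[i vi] := v_neq0.
suff -> : z = (a i)%:C by exact: ac.
apply: (mulfI vi); rewrite -mul_row_diagc vz mxE; exact: mulrC.
Qed.

Lemma diagcD a b : diagc a + diagc b = diagc (fun i => a i + b i).
Proof.
rewrite /diagc -raddfD /=; congr diag_mx; apply/rowP => i.
by rewrite !mxE rmorphD.
Qed.

Lemma psd_diagc a : (forall i, 0 <= a i) -> psdmx (diagc a).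
Proof.
move=> a_ge0; split.
  by apply/is_hermitianmxP; rewrite expr0 scale1r adj_diagc.
move=> x; rewrite mxE sumr_ge0 // => i _.
rewrite mul_row_diagc !mxE mulrAC mulrC mulr_ge0 ?ler0c //.
by rewrite mulrC mul_conjC_ge0.
Qed.

(** Multiplying by [al > 0] completes the square: the form becomes
    [|al x + r y|^2 + (al be - r^2) |y|^2]. *)
Lemma binary_form_ge0 (al be r : R) (x y : R[i]) :
    0 < al -> r ^+ 2 <= al * be ->
  0 <= al%:C * (x * x^*%R) + be%:C * (y * y^*%R) + r%:C * (x * y^*%R + y * x^*%R).
Proof.
move=> al_gt0 r2_le.
have al_gt0' : 0 < al%:C by rewrite ltcR.
rewrite -(pmulr_rge0 _ al_gt0').
set w := al%:C * x + r%:C * y.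
have -> : al%:C * (al%:C * (x * x^*%R) + be%:C * (y * y^*%R)
           + r%:C * (x * y^*%R + y * x^*%R)) =
    w * w^*%R + (al * be - r ^+ 2)%:C * (y * y^*%R).
  have wJ : w^*%R = al%:C * x^*%R + r%:C * y^*%R.
    by rewrite /w rmorphD !rmorphM /=; congr (_ * _ + _ * _); exact: conjc_real.
  by rewrite wJ /w rmorphB rmorphXn rmorphM /=; ring.
rewrite addr_ge0 ?mul_conjC_ge0 // mulr_ge0 ?mul_conjC_ge0 //.
by rewrite ler0c subr_ge0.
Qed.

Lemma psd_permc_block a b r s :
    (forall i, 0 < a i) -> (forall i, r ^+ 2 <= a i * b (s i)) ->
  psdmx (blockmx (diagc a) (permc r s) (diagc b)).
Proof.
move=> a_gt0 r2_le; split.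
  apply/is_hermitianmxP; rewrite expr0 scale1r /blockmx.
  rewrite tr_block_mx map_block_mx !adj_diagc; congr block_mx.
  by rewrite !adj_permc invgK.
move=> x; rewrite -[x]vsubmxK; move: (usubmx x) (dsubmx x) => {x} x y.
rewrite /blockmx adj_permc tr_col_mx map_row_mx mul_row_block mul_row_col.
(* Reindexing the [y] half by [s] pairs [x i] with [y (s i)], so the quadratic form becomes a sum of
   binary forms. *)
rewrite mxE ![(_ *m _) 0 0]mxE [X in _ + X](reindex_inj (@perm_inj _ s)) /=.
rewrite -big_split sumr_ge0 //= => i _.
rewrite [X in X * _ + _]mxE [X in _ + X * _]mxE !mul_row_diagc.
rewrite !mul_row_permc invgK permK !mxE.
have := binary_form_ge0 (x i 0) (y (s i) 0) (a_gt0 i) (r2_le i).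
by congr (_ <= _); ring.
Qed.

Lemma lambda1_permc_block_ge a b r s i t :
    a i = t -> b (s i) = t ->
  t + r <= lambda 1 (blockmx (diagc a) (permc r s) (diagc b)).
Proof.
move=> ai bi; rewrite -[t + r]/(complex.Re (t + r)%:C).
apply/lambda1_ge_eigenvalue/eigenvalueP.
(* This is the eigenvector [(1, 1)] of the 2x2 block [[[t, r], [r, t]]], placed at coordinates [i]
   and [s i] of the two halves. *)
exists (row_mx (delta_mx 0 i) (delta_mx 0 (s i))); last first.
  apply/rV0Pn; exists (lshift n i).
  by rewrite row_mxEl mxE !eqxx oner_neq0.
rewrite /blockmx adj_permc mul_row_block scale_row_mx.
congr row_mx; apply/rowP => j.
  rewrite mxE mul_row_diagc mul_row_permc invgK !mxE /=.
  rewrite (inj_eq perm_inj); case: eqP => [->|_] /=; last by rewrite !mul0r !mulr0 addr0.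
  by rewrite ai mul1r !mulr1 rmorphD.
rewrite -[j](permKV s) mxE mul_row_diagc mul_row_permc permK !mxE /=.
rewrite (inj_eq perm_inj); case: eqP => [->|_] /=; last by rewrite !mul0r !mulr0 addr0.
by rewrite bi mul1r !mulr1 rmorphD addrC.
Qed.

End PermutationBlock.

(** Addition in ['I_3] is modulo 3, so this is the cycle 0 -> 1 -> 2 -> 0. *)
Definition shift3 : 'S_3 := perm (addrI (1 : 'I_3)).

Theorem theorem5p1 (R : realType) :
  (forall r eps : R, 0 < r -> 0 < eps ->
     exists A B N : 'M[R[i]]_3,
       psdmx A /\ psdmx B /\ N \is normalmx /\
       psdmx (blockmx A N B) /\
       (forall z : R[i], eigenvalue N z -> `|z| <= r%:C) /\
       lambda 1 (blockmx A N B) > lambda 1 (A + B) + r - eps)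
  /\
  (forall kappa : R,
     (forall (n : nat) (A B N : 'M[R[i]]_n) (c : R[i]) (r : R),
        (0 < n)%N -> 0 < r ->
        psdmx (blockmx A N B) -> N \is normalmx -> spectrum_in_disk N c r ->
        lambda 1 (blockmx A N B) <= lambda 1 (A + B) + kappa * r) ->
     1 <= kappa).
Proof.
have sharp (r eps : R) : 0 < r -> 0 < eps ->
     exists A B N : 'M[R[i]]_3,
       psdmx A /\ psdmx B /\ N \is normalmx /\
       psdmx (blockmx A N B) /\
       (forall z : R[i], eigenvalue N z -> `|z| <= r%:C) /\
       lambda 1 (blockmx A N B) > lambda 1 (A + B) + r - eps.
  (* The bound [eps / 2] makes [d < eps] strict; the bound [r] gives [r <= h] below. *)
  move=> r_gt0 eps_gt0; pose d := Num.min r (eps / 2).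
  have d_gt0 : 0 < d by rewrite lt_min r_gt0 divr_gt0.
  have d_le_r : d <= r by rewrite ge_min lexx.
  have d_lt_eps : d < eps by rewrite gt_min; apply/orP; right; lra.
  (* The factor 2 keeps the last diagonal entry of the sum, [h + h = t], below [t + d]. *)
  pose h := r ^+ 2 / d; pose t := 2 * h.
  have dh : d * h = r ^+ 2 by rewrite /h mulrC divfK ?gt_eqF.
  have h_gt0 : 0 < h by rewrite divr_gt0 ?exprn_gt0.
  have r_le_h : r <= h by rewrite ler_pdivlMr // expr2 ler_pM2l.
  pose a (i : 'I_3) : R := [:: t; d; h]`_i.
  pose b (i : 'I_3) : R := [:: d; t; h]`_i.
  have a_gt0 i : 0 < a i.
    by case: i => -[|[|[|//]]] ? /=; rewrite /a /t /=; lra.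
  have b_gt0 i : 0 < b i.
    by case: i => -[|[|[|//]]] ? /=; rewrite /b /t /=; lra.
  exists (diagc a), (diagc b), (permc r shift3).
  split; first by apply: psd_diagc => i; exact: ltW.
  split; first by apply: psd_diagc => i; exact: ltW.
  split; first exact: permc_normal.
  split.
    (* The products [a i * b (s i)] are [t * t], [d * h] and [h * d]: the first is at least [r ^+ 2]
       because [r <= h], the others equal it. *)
    apply: psd_permc_block => // i; rewrite permE.
    by case: i => -[|[|[|//]]] ? /=; rewrite /a /b /t /=; nra.
  split; first by move=> z /(norm_eigenvalue_permc (ltW r_gt0)) ->.
  have ge_tr : t + r <= lambda 1 (blockmx (diagc a) (permc r shift3) (diagc b)).
    by apply: (@lambda1_permc_block_ge _ _ _ _ _ _ 0); rewrite ?permE.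
  have le_td : lambda 1 (diagc a + diagc b) <= t + d.
    rewrite diagcD; apply: lambda1_diagc_le => // i.
    by case: i => -[|[|[|//]]] ? /=; rewrite /a /b /t /=; lra.
  lra.
split=> // kappa bound; rewrite leNgt; apply/negP => kappa_lt1.
(* With [r = 1] and [eps = 1 - kappa], the strict lower bound is [lambda 1 (A + B) + kappa],
   contradicting [bound] on the disk centred at 0. *)
have [||A [B [N [_ [_ [nN [psdM [sN]]]]]]]] := sharp 1 (1 - kappa).
- exact: ltr01.
- by rewrite subr_gt0.
have sN0 : spectrum_in_disk N 0 1 by move=> z zN; rewrite subr0; exact: sN.
have := bound 3 A B N 0 1 isT ltr01 psdM nN sN0.
lra.
Qed.
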